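(* Let $R:\ell_{\infty}\rightarrow\ell_{\infty}$ be a linear bounded operator. The following are equivalent: (1) $R[c_0]\subseteq c_0$ and $R=(R|c_0)^{**}$ (under the identification $c_0^{**}=\ell_\infty$); (2) $R$ is given by a $c_0$-matrix; (3) $R$ is weak$^*$-weak$^*$-continuous and $R[c_0]\subseteq c_0$; (4) the restriction $R|B_{\ell_\infty}:(B_{\ell_{\infty}},\tau_p)\rightarrow(\ell_{\infty},\tau_p)$ is continuous and $R[c_0]\subseteq c_0$.
   Context: $\ell_\infty$ and $c_0$ are the real Banach spaces of bounded, respectively null, sequences indexed by $\mathbb{N}$; $B_{\ell_\infty}$ is the unit ball of $\ell_\infty$. The weak$^*$ topology on $\ell_\infty$ is given by the duality $\ell_1^{*}=\ell_\infty$, and $\tau_p$ is the product topology inherited from $\mathbb{R}^{\mathbb{N}}$. A real matrix $(b_{ij})_{i,j\in\mathbb{N}}$ is a $c_0$-matrix if every row $b_i=(b_{ij})_j$ is in $\ell_1$, the set $\{\|b_i\|_{\ell_1}:i\in\mathbb{N}\}$ is bounded, and every column $(b_{ij})_i$ is in $c_0$. $R$ is given by a $c_0$-matrix if there is a $c_0$-matrix $(b_{ij})$ with $R(f)(i)=\sum_{j\in\mathbb{N}}b_{ij}f(j)$ for all $f\in\ell_\infty$ and $i\in\mathbb{N}$. *)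

(* Defs.v *)
From HB Require Import structures.
From mathcomp Require Import all_boot all_order all_algebra.
From mathcomp Require Import all_classical all_reals all_analysis.

Set Implicit Arguments.
Unset Strict Implicit.
Unset Printing Implicit Defensive.

Import Order.TTheory GRing.Theory Num.Theory.
Import numFieldNormedType.Exports.

Local Open Scope classical_set_scope.
Local Open Scope ring_scope.

Section BoundedOperators.
Context {R : realType} (V W : normedModType R).

Definition bounded_linear : {pred V -> W} := fun T =>
  `[< linear T /\ exists M, forall x, `|T x| <= M * `|x| >].

Record bop := Bop { bop_fun :> V -> W ; _ : bop_fun \in bounded_linear }.

HB.instance Definition _ := [isSub for bop_fun].
HB.instance Definition _ := [Choice of bop by <:].

Lemma bop_linear (T : bop) : linear T.
Proof. by case: T => T /= /asboolP[]. Qed.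

Lemma bop_bounded (T : bop) : exists M, forall x, `|T x| <= M * `|x|.
Proof. by case: T => T /= /asboolP[]. Qed.

HB.instance Definition _ (T : bop) :=
  GRing.isLinear.Build R V W *:%R T (@bop_linear T).

Lemma bounded_linear_submod_closed : submod_closed bounded_linear.
Proof.
split.
  apply/asboolP; split; first by move=> a x y; rewrite /= scaler0 addr0.
  by exists 0 => x; rewrite [X in `|X|](_ : _ = 0)// normr0 mul0r.
move=> a S T /asboolP[lS [M HM]] /asboolP[lT [N HN]].
apply/asboolP; split.
  move=> b x y; rewrite !fctE lS lT !scalerDr !scalerA (mulrC a b).
  by rewrite addrACA.
exists (`|a| * M + N) => x; rewrite !fctE mulrDl.
apply: le_trans (ler_normD _ _) _; apply: lerD => //.
by rewrite normrZ -mulrA ler_wpM2l.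
Qed.

HB.instance Definition _ :=
  GRing.isSubmodClosed.Build _ _ bounded_linear bounded_linear_submod_closed.
HB.instance Definition _ := [SubChoice_isSubLmodule of bop by <:].

Definition opnorm (T : bop) : R :=
  sup [set `|T x| | x in [set x : V | `|x| <= 1]].

Lemma opnorm_has_sup (T : bop) :
  has_sup [set `|T x| | x in [set x : V | `|x| <= 1]].
Proof.
have [M HM] := bop_bounded T.
split; first by exists (`|T 0|); exists 0 => //=; rewrite normr0.
exists `|M| => _ [y /= y1 <-]; apply: le_trans (HM y) _.
apply: le_trans (_ : `|M| * `|y| <= _); first by rewrite ler_wpM2r// ler_norm.
by rewrite ler_piMr.
Qed.

Lemma opnorm_ub (T : bop) (x : V) : `|T x| <= opnorm T * `|x|.
Proof.
have [->|x0] := eqVneq x 0; first by rewrite linear0 !normr0 mulr0.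
rewrite -ler_pdivrMr ?normr_gt0//.
apply: (ub_le_sup (opnorm_has_sup T).2); exists (`|x|^-1 *: x) => /=.
  by rewrite normrZ normfV normr_id mulVf ?normr_eq0.
by rewrite linearZ/= normrZ normfV normr_id mulrC.
Qed.

Lemma opnorm_le (T : bop) (M : R) : 0 <= M ->
  (forall x, `|T x| <= M * `|x|) -> opnorm T <= M.
Proof.
move=> M0 HM; apply: ge_sup.
  by exists (`|T 0|); exists 0 => //=; rewrite normr0.
by move=> _ [y /= y1 <-]; apply: le_trans (HM y) _; rewrite ler_piMr.
Qed.

Lemma opnorm_ge0 (T : bop) : 0 <= opnorm T.
Proof.
apply: (ub_le_sup (opnorm_has_sup T).2); exists 0; first by rewrite /= normr0.
by rewrite linear0 normr0.
Qed.

Lemma bop_eqP (S T : bop) : S =1 T -> S = T.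
Proof. by move=> ST; apply/val_inj/funext. Qed.

Lemma opnormD (S T : bop) : opnorm (S + T) <= opnorm S + opnorm T.
Proof.
apply: opnorm_le => [|x]; first by rewrite addr_ge0 ?opnorm_ge0.
by rewrite mulrDl; apply: le_trans (ler_normD _ _) _; rewrite lerD ?opnorm_ub.
Qed.

Lemma opnorm_leZ (a : R) (T : bop) : opnorm (a *: T) <= `|a| * opnorm T.
Proof.
apply: opnorm_le => [|x]; first by rewrite mulr_ge0 ?opnorm_ge0.
by rewrite -mulrA [X in X <= _]normrZ ler_wpM2l ?opnorm_ub.
Qed.

Lemma opnormZ (a : R) (T : bop) : opnorm (a *: T) = `|a| * opnorm T.
Proof.
apply/eqP; rewrite eq_le opnorm_leZ /=.
have [->|a0] := eqVneq a 0; first by rewrite normr0 mul0r opnorm_ge0.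
rewrite -ler_pdivlMl ?normr_gt0// -normfV.
by rewrite -[X in opnorm X <= _](scalerK a0) opnorm_leZ.
Qed.

Lemma opnorm0_eq0 (T : bop) : opnorm T = 0 -> T = 0.
Proof.
move=> T0; apply: bop_eqP => x; apply/eqP; rewrite -normr_le0.
by apply: le_trans (opnorm_ub _ _) _; rewrite T0 mul0r.
Qed.

HB.instance Definition _ :=
  Lmodule_isNormed.Build R bop opnormD opnormZ opnorm0_eq0.

Lemma bop_norm_ub (T : bop) (x : V) : `|T x| <= `|T| * `|x|.
Proof. exact: opnorm_ub. Qed.

Lemma bop_norm_le (T : bop) (M : R) : 0 <= M ->
  (forall x, `|T x| <= M * `|x|) -> `|T| <= M.
Proof. exact: opnorm_le. Qed.

End BoundedOperators.

Arguments bounded_linear {R V W}.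

Definition dual {R : realType} (V : normedModType R) : normedModType R :=
  bop V R^o.

Section Adjoint.
Context {R : realType} {V W : normedModType R} (T : bop V W).

Lemma comp_bounded_linear (phi : dual W) :
  (phi \o T : V -> R^o) \in bounded_linear.
Proof.
apply/asboolP; split=> [a x y|]; first by rewrite /= !linearP.
exists (`|phi| * `|T|) => x /=; apply: le_trans (bop_norm_ub _ _) _.
by rewrite -mulrA ler_wpM2l// bop_norm_ub.
Qed.

Definition adjoint_fun (phi : dual W) : dual V := Bop (comp_bounded_linear phi).

Lemma adjoint_bounded_linear : adjoint_fun \in bounded_linear.
Proof.
apply/asboolP; split=> [a phi psi|]; first exact: bop_eqP.
exists `|T| => phi; apply: bop_norm_le => [|x]; first by rewrite mulr_ge0.
apply: le_trans (bop_norm_ub phi (T x)) _.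
by rewrite (mulrC `|T|) -mulrA; apply: ler_wpM2l => //; exact: bop_norm_ub.
Qed.

Definition adjoint : bop (dual W) (dual V) := Bop adjoint_bounded_linear.

End Adjoint.

Section SequenceSpaces.
Context {R : realType}.
Implicit Types (u v : nat -> R) (n : nat).

Definition is_linfty : {pred nat -> R} := fun u =>
  `[< exists M, forall n, `|u n| <= M >].

Definition is_lone : {pred nat -> R} := fun u => `[< cvgn [normed series u] >].

(* The norms are meaningful only under is_linfty, resp. is_lone. *)
Definition sup_norm u : R := sup (range (fun n => `|u n|)).

Definition lone_norm u : R := limn [normed series u].

Lemma is_linfty_submod_closed : submod_closed is_linfty.
Proof.
split.
  by apply/asboolP; exists 0 => n; rewrite [X in `|X|](_ : _ = 0)// normr0.
move=> a u v /asboolP[M HM] /asboolP[N HN]; apply/asboolP.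
exists (`|a| * M + N) => n; apply: le_trans (ler_normD _ _) _.
by rewrite lerD// normrM ler_wpM2l.
Qed.

Lemma normed_seriesS u n : [normed series u] n.+1 = [normed series u] n + `|u n|.
Proof. by rewrite /= /series/= big_nat_recr. Qed.

Lemma is_loneP u M : (forall n, [normed series u] n <= M) -> u \in is_lone.
Proof.
move=> HM; apply/asboolP; apply: nondecreasing_is_cvgn.
  by apply/nondecreasing_seqP => n; rewrite normed_seriesS lerDl.
by exists M => _ [n _ <-].
Qed.

Lemma lone_norm_ub u n : u \in is_lone -> [normed series u] n <= lone_norm u.
Proof.
move=> /asboolP cu; apply: nondecreasing_cvgn_le => //.
by apply/nondecreasing_seqP => k; rewrite normed_seriesS lerDl.
Qed.

Lemma lone_norm_le u M : (forall n, [normed series u] n <= M) -> lone_norm u <= M.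
Proof.
move=> HM; have /asboolP cu := is_loneP HM.
by apply: limr_le => //; apply: nearW.
Qed.

Lemma normed_seriesD u v n :
  [normed series (u + v)] n <= [normed series u] n + [normed series v] n.
Proof.
elim: n => [|n IHn]; first by rewrite /= /series/= !big_geq// addr0.
by rewrite !normed_seriesS addrACA lerD// ler_normD.
Qed.

Lemma normed_seriesZ a u n :
  [normed series (a *: u)] n = `|a| * [normed series u] n.
Proof.
elim: n => [|n IHn]; first by rewrite /= /series/= !big_geq// mulr0.
by rewrite !normed_seriesS mulrDr IHn -normrM.
Qed.

Lemma is_lone_submod_closed : submod_closed is_lone.
Proof.
split.
  apply: (@is_loneP _ 0); elim=> [|n IHn]; first by rewrite /= /series/= big_geq.
  by rewrite normed_seriesS [X in `|X|](_ : _ = 0)// normr0 addr0.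
move=> a u v lu lv; apply: (@is_loneP _ (`|a| * lone_norm u + lone_norm v)) => n.
apply: le_trans (normed_seriesD _ _ _) _.
by rewrite normed_seriesZ lerD ?ler_wpM2l ?lone_norm_ub.
Qed.

HB.instance Definition _ :=
  GRing.isSubmodClosed.Build _ _ is_linfty is_linfty_submod_closed.
HB.instance Definition _ :=
  GRing.isSubmodClosed.Build _ _ is_lone is_lone_submod_closed.

End SequenceSpaces.

Section Linfty.
Context {R : realType}.

Record linfty := Linfty { linfty_val :> nat -> R ; _ : linfty_val \in is_linfty }.

HB.instance Definition _ := [isSub for linfty_val].
HB.instance Definition _ := [Choice of linfty by <:].
HB.instance Definition _ := [SubChoice_isSubLmodule of linfty by <:].
Implicit Types f g : linfty.

Lemma sup_norm_has_sup f : has_sup (range (fun n => `|f n|)).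
Proof.
split; first by exists `|f 0|, 0.
by case: f => u /= /asboolP[M HM]; exists M => _ [n _ <-].
Qed.

Lemma sup_norm_ub f n : `|f n| <= sup_norm f.
Proof. by apply: (ub_le_sup (sup_norm_has_sup f).2); exists n. Qed.

Lemma sup_norm_ge0 f : 0 <= sup_norm f.
Proof. exact: le_trans (normr_ge0 _) (sup_norm_ub f 0%N). Qed.

Lemma sup_norm_le f M : (forall n, `|f n| <= M) -> sup_norm f <= M.
Proof.
move=> HM; apply: ge_sup; first exact: (sup_norm_has_sup f).1.
by move=> _ [n _ <-].
Qed.

Lemma sup_normD f g : sup_norm (f + g : linfty) <= sup_norm f + sup_norm g.
Proof.
apply: sup_norm_le => n; apply: le_trans (ler_normD _ _) _.
by rewrite lerD ?sup_norm_ub.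
Qed.

Lemma sup_norm_leZ a f : sup_norm (a *: f : linfty) <= `|a| * sup_norm f.
Proof.
by apply: sup_norm_le => n; rewrite [X in X <= _]normrM ler_wpM2l ?sup_norm_ub.
Qed.

Lemma sup_normZ a f : sup_norm (a *: f : linfty) = `|a| * sup_norm f.
Proof.
apply/eqP; rewrite eq_le sup_norm_leZ andTb.
have [->|a0] := eqVneq a 0.
  by rewrite normr0 mul0r; exact: sup_norm_ge0.
rewrite -ler_pdivlMl ?normr_gt0// -normfV.
by rewrite -[X in sup_norm (linfty_val X) <= _](scalerK a0) sup_norm_leZ.
Qed.

Lemma sup_norm0_eq0 f : sup_norm f = 0 -> f = 0.
Proof.
move=> f0; apply/val_inj/funext => n; apply/eqP; rewrite -normr_le0.
by rewrite -[X in _ <= X]f0 sup_norm_ub.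
Qed.

HB.instance Definition _ :=
  Lmodule_isNormed.Build R linfty sup_normD sup_normZ sup_norm0_eq0.

Lemma linfty_norm_ub f n : `|f n| <= `|f|.
Proof. exact: sup_norm_ub. Qed.

Lemma linfty_norm_le f M : (forall n, `|f n| <= M) -> `|f| <= M.
Proof. exact: sup_norm_le. Qed.

End Linfty.
Arguments linfty R : clear implicits.

Section Lone.
Context {R : realType}.

Record lone := Lone { lone_val :> nat -> R ; lone_valP : lone_val \in is_lone }.

HB.instance Definition _ := [isSub for lone_val].
HB.instance Definition _ := [Choice of lone by <:].
HB.instance Definition _ := [SubChoice_isSubLmodule of lone by <:].
Implicit Types f g : lone.

Lemma lone_normD f g : lone_norm (f + g : lone) <= lone_norm f + lone_norm g.
Proof.
apply: lone_norm_le => n; apply: le_trans (normed_seriesD _ _ _) _.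
by rewrite lerD ?lone_norm_ub ?lone_valP.
Qed.

Lemma lone_normZ a f : lone_norm (a *: f : lone) = `|a| * lone_norm f.
Proof.
rewrite /lone_norm (_ : [normed series (a *: f)] = `|a| *: [normed series f]).
  by rewrite limZl_tmp//; apply/asboolP/lone_valP.
by apply/funext => n; rewrite normed_seriesZ.
Qed.

Lemma lone_norm0_eq0 f : lone_norm f = 0 -> f = 0.
Proof.
move=> f0; apply/val_inj/funext => n; apply/eqP; rewrite -normr_le0.
rewrite -[X in _ <= X]f0; apply: (le_trans _ (lone_norm_ub n.+1 (lone_valP f))).
rewrite normed_seriesS lerDr; apply: sumr_ge0 => *; exact: normr_ge0.
Qed.

HB.instance Definition _ :=
  Lmodule_isNormed.Build R lone lone_normD lone_normZ lone_norm0_eq0.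

Lemma lone_normE f : `|f| = lone_norm f.
Proof. by []. Qed.

End Lone.
Arguments lone R : clear implicits.

Section C0.
Context {R : realType}.

(* Null sequences are bounded, so this is all of c0. *)
Definition c0_set : set (linfty R) :=
  [set f | (f : nat -> R) @ \oo --> (0 : R)].

Definition is_c0 : {pred linfty R} := fun f => `[< c0_set f >].

Lemma is_c0_submod_closed : submod_closed is_c0.
Proof.
split; first by apply/asboolP; exact: cvg_cst.
move=> a f g /asboolP cf /asboolP cg; apply/asboolP.
by have := cvgD (cvgZl_tmp (k := a) cf) cg; rewrite scaler0 addr0; exact.
Qed.

HB.instance Definition _ :=
  GRing.isSubmodClosed.Build _ _ is_c0 is_c0_submod_closed.

Record c0 := C0 { c0_val :> linfty R ; c0_valP : c0_val \in is_c0 }.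

HB.instance Definition _ := [isSub for c0_val].
HB.instance Definition _ := [Choice of c0 by <:].
HB.instance Definition _ := [SubChoice_isSubLmodule of c0 by <:].

Definition c0_norm (x : c0) : R := `|c0_val x|.

Lemma c0_normD (x y : c0) : c0_norm (x + y) <= c0_norm x + c0_norm y.
Proof. exact: ler_normD. Qed.

Lemma c0_normZ a (x : c0) : c0_norm (a *: x) = `|a| * c0_norm x.
Proof. exact: normrZ. Qed.

Lemma c0_norm0_eq0 (x : c0) : c0_norm x = 0 -> x = 0.
Proof. by move=> /normr0_eq0 x0; exact: val_inj. Qed.

HB.instance Definition _ :=
  Lmodule_isNormed.Build R c0 c0_normD c0_normZ c0_norm0_eq0.

Lemma c0_normE (x : c0) : `|x| = `|c0_val x|.
Proof. by []. Qed.

End C0.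
Arguments c0 R : clear implicits.

Section RestrictC0.
Context {R : realType} (T : bop (linfty R) (linfty R)).
Context (Tc0 : T @` c0_set `<=` c0_set).

Lemma restrict_c0_subproof (x : c0 R) : T x \in is_c0.
Proof. by apply/asboolP/Tc0; exists (c0_val x) => //; exact/asboolP/c0_valP. Qed.

Definition restrict_c0_fun (x : c0 R) : c0 R := C0 (restrict_c0_subproof x).

Lemma restrict_c0_bounded_linear : restrict_c0_fun \in bounded_linear.
Proof.
apply/asboolP; split=> [a x y|]; first by apply: val_inj; exact: linearP.
by exists `|T| => x; exact: bop_norm_ub.
Qed.

Definition restrict_c0 : bop (c0 R) (c0 R) := Bop restrict_c0_bounded_linear.

End RestrictC0.

Section LinftyDual.
Context {R : realType}.

Definition pairing (u v : nat -> R) : R := limn (series (fun j => u j * v j)).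

Lemma is_cvg_normed_pairing (f : linfty R) (g : lone R) :
  cvgn [normed series (fun j => g j * f j)].
Proof.
apply/asboolP; apply: (@is_loneP _ _ (lone_norm g * `|f|)) => n.
apply: le_trans (_ : [normed series g] n * `|f| <= _); last first.
  by rewrite ler_wpM2r// lone_norm_ub// lone_valP.
elim: n => [|n IHn]; first by rewrite /= /series/= !big_geq// mul0r.
rewrite !normed_seriesS mulrDl lerD// normrM ler_wpM2l//.
exact: linfty_norm_ub.
Qed.

Lemma is_cvg_pairing (f : linfty R) (g : lone R) :
  cvgn (series (fun j => g j * f j)).
Proof. apply: normed_cvg; exact: is_cvg_normed_pairing. Qed.

Lemma pairing_le (f : linfty R) (g : lone R) : `|pairing g f| <= `|f| * `|g|.
Proof.
have le_lim := lim_series_norm (@is_cvg_normed_pairing f g).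
apply: (le_trans le_lim).
apply: limr_le; first exact: is_cvg_normed_pairing.
apply: nearW => n; rewrite mulrC.
apply: le_trans (_ : [normed series g] n * `|f| <= _); last first.
  by rewrite ler_wpM2r// lone_norm_ub// lone_valP.
elim: n => [|n IHn]; first by rewrite /= /series/= !big_geq// mul0r.
rewrite !normed_seriesS mulrDl lerD// normrM ler_wpM2l//.
exact: linfty_norm_ub.
Qed.

Lemma pairing_linearl (f : linfty R) a (g h : lone R) :
  pairing (a *: g + h : lone R) f = a * pairing g f + pairing h f.
Proof.
rewrite /pairing.
transitivity (limn (a *: series (fun j => g j * f j) + series (fun j => h j * f j))).
  congr (limn _); rewrite -seriesZ -seriesD; congr series.
  by apply/funext => j; rewrite /= mulrDl -mulrA.
have cg := @is_cvg_pairing f g; have ch := @is_cvg_pairing f h.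
rewrite limD ?limZl_tmp//; exact: cvgZl_tmp.
Qed.

Lemma pairing_linearr (g : lone R) a (f h : linfty R) :
  pairing g (a *: f + h : linfty R) = a * pairing g f + pairing g h.
Proof.
rewrite /pairing.
transitivity (limn (a *: series (fun j => g j * f j) + series (fun j => g j * h j))).
  congr (limn _); rewrite -seriesZ -seriesD; congr series.
  by apply/funext => j; rewrite /= mulrDr mulrCA.
have cf := @is_cvg_pairing f g; have ch := @is_cvg_pairing h g.
rewrite limD ?limZl_tmp//; exact: cvgZl_tmp.
Qed.

Lemma linfty_functional_bounded_linear (f : linfty R) :
  (fun g : lone R => pairing g f : R^o) \in bounded_linear.
Proof.
apply/asboolP; split=> [a g h|]; first exact: pairing_linearl.
by exists `|f| => g; exact: pairing_le.
Qed.

Definition linfty_functional (f : linfty R) : dual (lone R) :=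
  Bop (linfty_functional_bounded_linear f).

Lemma lone_dual_bounded_linear : linfty_functional \in bounded_linear.
Proof.
apply/asboolP; split=> [a f h|].
  by apply: bop_eqP => g; exact: pairing_linearr.
exists 1 => f; rewrite mul1r; apply: bop_norm_le => // g; exact: pairing_le.
Qed.

Definition linfty_to_lone_dual : bop (linfty R) (dual (lone R)) :=
  Bop lone_dual_bounded_linear.

End LinftyDual.

Section C0Dual.
Context {R : realType}.

Definition unit_seq (n j : nat) : R := (j == n)%:R.

Lemma unit_seq_is_linfty n : unit_seq n \in is_linfty.
Proof.
by apply/asboolP; exists 1 => j; rewrite /unit_seq; case: eqP; rewrite ?normr0 ?normr1.
Qed.

Lemma unit_seq_is_c0 n : Linfty (unit_seq_is_linfty n) \in is_c0.
Proof.
apply/asboolP => /=; apply: cvg_near_cst; exists n.+1 => // j /= nj.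
by rewrite /unit_seq gtn_eqF.
Qed.

Definition c0_unit n : c0 R := C0 (unit_seq_is_c0 n).

Lemma c0_coef_le (phi : dual (c0 R)) n :
  [normed series (fun j => phi (c0_unit j))] n <= `|phi|.
Proof.
pose x := \sum_(0 <= k < n) Num.sg (phi (c0_unit k)) *: c0_unit k.
have -> : [normed series (fun j => phi (c0_unit j))] n = phi x.
  rewrite linear_sum; apply: eq_bigr => k _.
  by rewrite linearZ/= normrEsg.
apply: le_trans (ler_norm _) _; apply: le_trans (bop_norm_ub _ _) _.
rewrite ler_piMr//; apply: linfty_norm_le => j.
have xE m : c0_val (\sum_(0 <= k < m) Num.sg (phi (c0_unit k)) *: c0_unit k) j
    = if (j < m)%N then Num.sg (phi (c0_unit j)) else 0.
  elim: m => [|m IHm]; first by rewrite big_geq.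
  rewrite big_nat_recr//=.
  rewrite [LHS](_ : _ = c0_val (\sum_(0 <= k < m) Num.sg (phi (c0_unit k)) *: c0_unit k) j
    + Num.sg (phi (c0_unit m)) * unit_seq m j)// IHm /unit_seq ltnS.
  by case: (ltngtP j m) => [||->]; rewrite ?mulr0 ?mulr1 ?addr0 ?add0r.
by rewrite xE; case: ifP => _; rewrite ?normr0// normr_sg lern1 leq_b1.
Qed.

Definition c0_coef (phi : dual (c0 R)) : lone R :=
  Lone (is_loneP (c0_coef_le phi)).

Lemma c0_coef_bounded_linear : c0_coef \in bounded_linear.
Proof.
apply/asboolP; split=> [a phi psi|]; first exact: val_inj.
by exists 1 => phi; rewrite mul1r; apply: lone_norm_le; exact: c0_coef_le.
Qed.

Definition c0_dual_to_lone : bop (dual (c0 R)) (lone R) :=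
  Bop c0_coef_bounded_linear.

(* The identification of l_infty with the bidual of c0: the adjoint of
   dual c0 = l_1 (phi |-> (phi e_n)_n) applied to l_infty = dual l_1, that is,
   f |-> (phi |-> \sum_n phi e_n * f n). It is an isometric bijection, see
   linfty_to_c0_bidual_bij and linfty_to_c0_bidual_norm below. *)
Definition linfty_to_c0_bidual (f : linfty R) : dual (dual (c0 R)) :=
  adjoint c0_dual_to_lone (linfty_to_lone_dual f).

End C0Dual.

Section Topologies.
Context {R : realType}.

(* {ptws V -> R^o} is the product topology on V -> R, so this is the coarsest
   topology on the dual of V making all evaluations at points of V continuous. *)
Definition weak_star (V : normedModType R) : Type :=
  initial_topology (fun phi : dual V => (phi : {ptws V -> R^o})).

HB.instance Definition _ (V : normedModType R) := Topological.on (weak_star V).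

Definition linfty_weak_star : Type :=
  initial_topology (linfty_to_lone_dual : linfty R -> weak_star (lone R)).

HB.instance Definition _ := Topological.on linfty_weak_star.

Definition linfty_pointwise : Type :=
  initial_topology (fun f : linfty R => (f : {ptws nat -> R})).

HB.instance Definition _ := Topological.on linfty_pointwise.

(* The carrier of this set is linfty_pointwise, so that its subspace topology is
   induced by the product topology rather than by the norm. *)
Definition linfty_ball : set linfty_pointwise :=
  [set f | `|f : linfty R| <= 1].

End Topologies.
Arguments linfty_weak_star R : clear implicits.
Arguments linfty_pointwise R : clear implicits.
Arguments linfty_ball R : clear implicits.

Section C0Matrix.
Context {R : realType}.

Definition c0_matrix (b : nat -> nat -> R) : Prop :=
  [/\ forall i, b i \in is_lone,
      exists M, forall i, lone_norm (b i) <= M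
    & forall j, b^~ j @ \oo --> (0 : R)].

Definition given_by_c0_matrix (T : bop (linfty R) (linfty R)) : Prop :=
  exists2 b : nat -> nat -> R, c0_matrix b &
    forall (f : linfty R) i, T f i = limn (series (fun j => b i j * f j)).

End C0Matrix.

Section Identifications.
Context {R : realType}.

Lemma cvg_ge0_squeeze (u v : nat -> R) :
  (forall n, 0 <= u n <= v n) -> v @ \oo --> (0 : R) -> u @ \oo --> (0 : R).
Proof.
move=> uv v0; apply: (squeeze_cvgr _ (cvg_cst (0 : R)) v0); exact: nearW.
Qed.

Lemma cvg_bop (V : normedModType R) (phi : dual V) (y : nat -> V) (x : V) :
  (fun n => `|x - y n|) @ \oo --> (0 : R) ->
  (fun n => phi (y n) : R) @ \oo --> (phi x : R).
Proof.
move=> xy; have cxy : (fun n => `|phi| * `|x - y n|) @ \oo --> (0 : R).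
  by rewrite -(mulr0 `|phi|); exact: (cvgZl_tmp (k := `|phi|) xy).
apply/cvgrPdist_le => e e0; have /cvgrPdist_le/(_ e e0)[N _ HN] := cxy.
exists N => // n /= Nn; rewrite -linearB; apply: le_trans (bop_norm_ub _ _) _.
apply: le_trans (ler_norm _) _.
by have := HN n Nn; rewrite sub0r normrN; exact.
Qed.

Lemma lone_unit_sum_le n m : [normed series (unit_seq n : nat -> R)] m <= 1.
Proof.
have -> : [normed series (unit_seq n : nat -> R)] m = (n < m)%:R.
  elim: m => [|m IHm]; first by rewrite /= /series/= big_geq.
  rewrite normed_seriesS IHm /unit_seq ltnS.
  by case: (ltngtP n m) => _; rewrite ?normr0 ?normr1 ?addr0 ?add0r.
by rewrite lern1 leq_b1.
Qed.

Definition lone_unit n : lone R := Lone (is_loneP (lone_unit_sum_le n)).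

Lemma lone_unit_norm n : `|lone_unit n| <= 1.
Proof. by apply: lone_norm_le; exact: lone_unit_sum_le. Qed.

Lemma c0_unit_norm n : `|c0_unit n : c0 R| <= 1.
Proof.
apply: linfty_norm_le => j; rewrite /= /unit_seq.
by case: eqP; rewrite ?normr0 ?normr1.
Qed.

Definition lone_trunc (g : lone R) n : lone R :=
  \sum_(0 <= k < n) g k *: lone_unit k.

Definition c0_trunc (x : c0 R) n : c0 R :=
  \sum_(0 <= k < n) x k *: c0_unit k.

Lemma lone_truncE g n j : lone_trunc g n j = if (j < n)%N then g j else 0.
Proof.
rewrite /lone_trunc; elim: n => [|n IHn]; first by rewrite big_geq.
rewrite big_nat_recr//=.
rewrite [LHS](_ : _ = lone_val (\sum_(0 <= k < n) g k *: lone_unit k) j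
  + g n * unit_seq n j)// IHn /unit_seq ltnS.
by case: (ltngtP j n) => [||->]; rewrite ?mulr0 ?mulr1 ?addr0 ?add0r.
Qed.

Lemma c0_truncE x n j : c0_trunc x n j = if (j < n)%N then x j else 0.
Proof.
rewrite /c0_trunc; elim: n => [|n IHn]; first by rewrite big_geq.
rewrite big_nat_recr//=.
rewrite [LHS](_ : _ = c0_val (\sum_(0 <= k < n) x k *: c0_unit k) j
  + x n * unit_seq n j)// IHn /unit_seq ltnS.
by case: (ltngtP j n) => [||->]; rewrite ?mulr0 ?mulr1 ?addr0 ?add0r.
Qed.

Lemma lone_trunc_le g n : `|g - lone_trunc g n| <= `|g| - [normed series g] n.
Proof.
apply: lone_norm_le => m.
have subE j : (g - lone_trunc g n) j = if (j < n)%N then 0 else g j.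
  rewrite [LHS](_ : _ = g j - lone_trunc g n j)// lone_truncE.
  by case: ifP => _; rewrite ?subrr ?subr0.
rewrite lerBrDr; apply: le_trans (lone_norm_ub (maxn m n) (lone_valP g)).
elim: m => [|m IHm]; first by rewrite max0n /= /series/= big_geq// add0r.
rewrite normed_seriesS subE; case: ifPn => [mn|]; last rewrite -leqNgt => nm.
  by rewrite normr0 addr0 (maxn_idPr mn) (le_trans IHm)// (maxn_idPr (ltnW mn)).
rewrite (maxn_idPl (leqW nm)) normed_seriesS addrAC lerD2r (le_trans IHm)//.
by rewrite (maxn_idPl nm).
Qed.

Lemma lone_trunc_cvg g : (fun n => `|g - lone_trunc g n|) @ \oo --> (0 : R).
Proof.
apply: (@cvg_ge0_squeeze _ (fun n => `|g| - [normed series g] n)).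
  by move=> n; rewrite normr_ge0 lone_trunc_le.
rewrite -(subrr (`|g|)); apply: cvgB; first exact: cvg_cst.
by apply/asboolP/lone_valP.
Qed.

Lemma c0_trunc_cvg x : (fun n => `|x - c0_trunc x n|) @ \oo --> (0 : R).
Proof.
have /asboolP x0 := c0_valP x.
apply/cvgrPdist_le => e e0; have /cvgrPdist_le/(_ e e0)[N _ HN] := x0.
exists N => // n /= Nn; rewrite sub0r normrN normr_id.
apply: linfty_norm_le => j.
rewrite [X in `|X|](_ : _ = x j - c0_trunc x n j)// c0_truncE.
case: ifPn => [_|]; first by rewrite subrr normr0 ltW.
rewrite -leqNgt subr0 => nj; have := HN j (leq_trans Nn nj).
by rewrite sub0r normrN.
Qed.

Lemma pairing_unitl (u : nat -> R) n : pairing (unit_seq n) u = u n.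
Proof.
apply/cvg_lim => //; apply: cvg_near_cst; exists n.+1 => // m /= nm.
rewrite /series/= (bigD1_seq n) ?mem_index_iota ?iota_uniq//=.
rewrite /unit_seq eqxx mul1r big1 ?addr0// => j /negPf ->.
by rewrite mul0r.
Qed.

Lemma pairingC (u v : nat -> R) : pairing u v = pairing v u.
Proof. by congr (limn (series _)); apply/funext => j; rewrite mulrC. Qed.

Lemma lone_dual_series (psi : dual (lone R)) (g : lone R) :
  psi g = pairing g (fun n => psi (lone_unit n)).
Proof.
apply/esym/cvg_lim => //; have := @cvg_bop _ psi _ _ (lone_trunc_cvg g).
rewrite (_ : (fun n => _) = series (fun j => g j * psi (lone_unit j))); first exact.
apply/funext => n; rewrite linear_sum; apply: eq_bigr => j _.
by rewrite linearZ.
Qed.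

Lemma c0_dual_series (phi : dual (c0 R)) (x : c0 R) :
  phi x = pairing x (c0_dual_to_lone phi).
Proof.
apply/esym/cvg_lim => //; have := @cvg_bop _ phi _ _ (c0_trunc_cvg x).
rewrite (_ : (fun n => _) = series (fun j => x j * c0_dual_to_lone phi j)); first exact.
apply/funext => n; rewrite linear_sum; apply: eq_bigr => j _.
by rewrite linearZ.
Qed.

Lemma inj_surj_bij (A B : Type) (h : A -> B) :
  injective h -> (forall y, exists x, h x = y) -> bijective h.
Proof.
move=> inj surj; rewrite -setTT_bijective; split=> //.
  by move=> x y _ _; exact: inj.
by move=> y _; have [x <-] := surj y; exists x.
Qed.

Lemma linfty_to_lone_dual_bij : bijective (@linfty_to_lone_dual R).
Proof.
apply: inj_surj_bij => [f h fh|psi].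
  apply/val_inj/funext => n.
  have := congr1 (fun psi : dual (lone R) => psi (lone_unit n)) fh.
  by rewrite /= !pairing_unitl.
have lf : (fun n => psi (lone_unit n)) \in is_linfty.
  apply/asboolP; exists `|psi| => n; apply: le_trans (bop_norm_ub _ _) _.
  by rewrite ler_piMr// lone_unit_norm.
by exists (Linfty lf); apply: bop_eqP => g; rewrite [RHS]lone_dual_series.
Qed.

Lemma linfty_to_lone_dual_norm (f : linfty R) : `|linfty_to_lone_dual f| = `|f|.
Proof.
apply/eqP; rewrite eq_le; apply/andP; split.
  by apply: bop_norm_le => // g; exact: pairing_le.
apply: linfty_norm_le => n; rewrite -(pairing_unitl f n).
apply: le_trans (bop_norm_ub (linfty_to_lone_dual f) (lone_unit n)) _.
by rewrite ler_piMr// lone_unit_norm.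
Qed.

Lemma c0_functional_bounded_linear (g : lone R) :
  (fun x : c0 R => pairing g x : R^o) \in bounded_linear.
Proof.
apply/asboolP; split=> [a x y|]; first exact: (pairing_linearr g a x y).
by exists `|g| => x; rewrite mulrC; exact: pairing_le.
Qed.

Definition c0_functional (g : lone R) : dual (c0 R) :=
  Bop (c0_functional_bounded_linear g).

Lemma c0_functionalK : cancel c0_functional (@c0_dual_to_lone R).
Proof.
move=> g; apply/val_inj/funext => n /=.
by rewrite pairingC pairing_unitl.
Qed.

Lemma c0_dual_to_loneK : cancel (@c0_dual_to_lone R) c0_functional.
Proof.
by move=> phi; apply: bop_eqP => x; rewrite [RHS]c0_dual_series pairingC.
Qed.

Lemma c0_dual_to_lone_bij : bijective (@c0_dual_to_lone R).
Proof. exact: Bijective c0_dual_to_loneK c0_functionalK. Qed.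

Lemma c0_dual_to_lone_norm (phi : dual (c0 R)) : `|c0_dual_to_lone phi| = `|phi|.
Proof.
apply/eqP; rewrite eq_le; apply/andP; split.
  by apply: lone_norm_le; exact: c0_coef_le.
apply: bop_norm_le => // x; rewrite c0_dual_series pairingC mulrC.
exact: pairing_le.
Qed.

Lemma linfty_to_c0_bidual_bij : bijective (@linfty_to_c0_bidual R).
Proof.
apply: inj_surj_bij => [f h fh|Phi].
  apply: (bij_inj linfty_to_lone_dual_bij); apply: bop_eqP => g.
  have H : linfty_to_lone_dual f (c0_dual_to_lone (c0_functional g)) =
           linfty_to_lone_dual h (c0_dual_to_lone (c0_functional g)).
    exact: (congr1 (fun Phi : dual (dual (c0 R)) => Phi (c0_functional g)) fh).
  by rewrite !c0_functionalK in H.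
have lPsi : (fun g : lone R => Phi (c0_functional g)) \in bounded_linear.
  apply/asboolP; split=> [a g h|].
    rewrite -linearP; congr (Phi _); apply: bop_eqP => x.
    exact: (pairing_linearl x a g h).
  exists `|Phi| => g; apply: le_trans (bop_norm_ub _ _) _.
  by rewrite -c0_dual_to_lone_norm c0_functionalK.
have [K _ KK] := linfty_to_lone_dual_bij.
exists (K (Bop lPsi)); apply: bop_eqP => phi.
transitivity (linfty_to_lone_dual (K (Bop lPsi)) (c0_dual_to_lone phi)) => //.
by rewrite KK; congr (Phi _); exact: c0_dual_to_loneK.
Qed.

Lemma linfty_to_c0_bidual_norm (f : linfty R) : `|linfty_to_c0_bidual f| = `|f|.
Proof.
rewrite -linfty_to_lone_dual_norm; apply/eqP; rewrite eq_le; apply/andP; split.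
  apply: bop_norm_le => // phi; rewrite -(c0_dual_to_lone_norm phi).
  exact: (bop_norm_ub (linfty_to_lone_dual f) (c0_dual_to_lone phi)).
apply: bop_norm_le => // g.
rewrite -[X in _ <= _ * `|X|]c0_functionalK c0_dual_to_lone_norm.
rewrite -{1}(c0_functionalK g).
exact: (bop_norm_ub (linfty_to_c0_bidual f) (c0_functional g)).
Qed.

End Identifications.

(* Main.v *)
Require Import Defs.
From mathcomp Require Import all_boot all_order all_algebra.
From mathcomp Require Import all_classical all_reals all_analysis.
From mathcomp Require Import ring.
Import Order.TTheory GRing.Theory Num.Theory.
Import numFieldNormedType.Exports.
Local Open Scope classical_set_scope.
Local Open Scope ring_scope.

(** Once T maps c0 into c0, its restriction S to c0 has an adjoint S^* on
    dual c0 = l_1, and the candidate matrix is forced: its i-th row is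
    S^*(e_i) in l_1, with entries T(e_j)(i).  That the rows have norms at most
    |T| and that the columns T(e_j) are null is then automatic
    (matrix_row_c0_matrix), so all four conditions say the same thing: T acts on
    the whole of l_infty, and not only on c0, through these rows.

    - Bidual.  The identity between T and S^** states that
      <g, T f> = <S^* g, f> for all g in l_1.  Taking g = e_i gives the row
      formula.  Conversely, both sides are bounded linear in g, and an element
      of the dual of l_1 is determined by its values on the e_i, so the row
      formula gives the identity (preadjointP, bidual_extensionP).
    - Matrix.  A c0-matrix has columns T(e_j) in c0; since the e_j span a dense
      subspace of c0 and c0 is closed, T preserves c0, and the matrix must be
      the one above (given_by_c0_matrixP).
    - Weak* continuity follows because <g, T f> = <S^* g, f> turns each weak*
      evaluation of T into another weak* evaluation.  It implies continuity on
      the ball for the product topology, because on bounded sets pointwise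
      convergence implies weak* convergence: g in l_1 is a norm limit of
      finitely supported sequences (bounded_pointwise_cvg_pairing).
    - Continuity on the ball gives back the row formula: the finite sections
      of f stay in a ball and converge pointwise to f, and T maps them to the
      partial sums of the row series (row_formula_of_within_ball_continuous). *)

(** * Convergence in the weak* and product topologies *)

Lemma initial_cvgP {S : choiceType} {T : topologicalType} (h : S -> T)
    (F : set_system S) (x : S) : Filter F ->
  (F --> (x : initial_topology h)) <-> (h @ F --> h x).
Proof.
move=> FF; split=> [Fx|hFx].
  by move=> A /initial_continuous/Fx.
move=> A [_ [[B oB <-] Bx] BA]; apply: filterS BA _.
by apply: hFx; exact: open_nbhs_nbhs.
Qed.

Lemma ptws_cvgP {I : Type} {U : topologicalType} (F : set_system (I -> U))
    (u : I -> U) : Filter F ->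
  {ptws, F --> u} <-> forall i, (fun v => v i) @ F --> u i.
Proof.
move=> FF; split.
  by move=> /cvg_sup Fu i; apply/initial_cvgP/Fu.
by move=> Fu; apply/cvg_sup => i; apply/initial_cvgP/Fu.
Qed.

Section Convergence.
Context {R : realType}.
Implicit Types (F : set_system (linfty R)) (f : linfty R) (g : lone R).

Lemma linfty_weak_star_cvgP F f : Filter F ->
  (F --> (f : linfty_weak_star R)) <->
  forall g, (fun h : linfty R => pairing g h) @ F --> pairing g f.
Proof.
move=> FF.
by split=> [/initial_cvgP/initial_cvgP/ptws_cvgP|] Ff; [|
  apply/initial_cvgP/initial_cvgP/ptws_cvgP].
Qed.

Lemma linfty_pointwise_cvgP F f : Filter F ->
  (F --> (f : linfty_pointwise R)) <->
  forall i, (fun h : linfty R => h i) @ F --> f i.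
Proof.
move=> FF.
by split=> [/initial_cvgP/ptws_cvgP|] Ff; [|apply/initial_cvgP/ptws_cvgP].
Qed.


Lemma pairing_lone_trunc g n f :
  pairing (lone_trunc g n) f = \sum_(0 <= k < n) g k * f k.
Proof.
rewrite -[LHS]/(linfty_to_lone_dual f (lone_trunc g n)) linear_sum.
by apply: eq_bigr => k _; rewrite linearZ/= pairing_unitl.
Qed.

Lemma pairingBl g1 g2 f :
  pairing (g1 - g2 : lone R) f = pairing g1 f - pairing g2 f.
Proof. exact: (linearB (linfty_to_lone_dual f) g1 g2). Qed.

Lemma pairingBr g f1 f2 :
  pairing g (f1 - f2 : linfty R) = pairing g f1 - pairing g f2.
Proof.
exact: (congr1 (fun psi : dual (lone R) => psi g)
  (linearB linfty_to_lone_dual f1 f2)).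
Qed.

(** On bounded sets pointwise convergence implies weak* convergence.  Replacing
    g by a finite section costs at most |f - h| times the l_1 norm of the tail,
    which is small uniformly over the bounded set, and a finitely supported g
    sees only finitely many coordinates. *)
Lemma bounded_pointwise_cvg_pairing F (M : R) f g : Filter F ->
    (\forall h \near F, `|h| <= M) ->
    (forall i, (fun h : linfty R => h i) @ F --> f i) ->
  (fun h : linfty R => pairing g h) @ F --> pairing g f.
Proof.
move=> FF FM Ff; apply/cvgrPdist_le => e e0.
(* |M| instead of M, and the summand 1, only keep the divisor positive. *)
have K0 : 0 < `|f| + `|M| + 1 by rewrite ltr_wpDl// addr_ge0.
have eK0 : 0 < e / 2 / (`|f| + `|M| + 1) by rewrite !divr_gt0.
have /cvgrPdist_le/(_ _ eK0)[n _ /(_ n (leqnn n))] := lone_trunc_cvg g.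
rewrite sub0r normrN normr_id => gn.
have : (fun h : linfty R => \sum_(0 <= k < n) g k * h k) @ F -->
       \sum_(0 <= k < n) g k * f k.
  elim: n {gn} => [|n IHn].
    under eq_fun do rewrite big_geq//.
    by rewrite big_geq//; exact: cvg_cst.
  under eq_fun do rewrite big_nat_recr//=.
  by rewrite big_nat_recr//=; apply: cvgD => //; apply: cvgZl_tmp; exact: Ff.
move=> /cvgrPdist_le/(_ (e / 2)); rewrite divr_gt0// => /(_ isT) Fn.
near=> h.
have -> : pairing g f - pairing g h =
    pairing (g - lone_trunc g n : lone R) (f - h : linfty R) +
    (\sum_(0 <= k < n) g k * f k - \sum_(0 <= k < n) g k * h k).
  rewrite -!pairing_lone_trunc.
  by rewrite pairingBl !pairingBr; ring.
rewrite [leRHS](splitr e); apply: le_trans (ler_normD _ _) _; apply: lerD.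
  apply: le_trans (pairing_le _ _) _; rewrite mulrC.
  apply: (@le_trans _ _ (e / 2 / (`|f| + `|M| + 1) * (`|f| + `|M| + 1))).
    apply: ler_pM => //; apply: le_trans (ler_normB _ _) _.
    rewrite -addrA lerD2l; apply: (@le_trans _ _ `|M|); last by rewrite lerDl.
    by apply: le_trans (ler_norm _); near: h.
  by rewrite divfK// gt_eqF.
by near: h.
Unshelve. all: by end_near.
Qed.

End Convergence.

(** * The pre-adjoint of an operator preserving c0 *)

Section Preadjoint.
Context {R : realType} {T : bop (linfty R) (linfty R)}.
Context (Tc0 : T @` c0_set `<=` c0_set).
Implicit Types (f : linfty R) (g : lone R).

(** The adjoint of the restriction of T to c0, read on l_1 through the
    identification of l_1 with the dual of c0. *)
Definition preadjoint g : lone R :=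
  c0_dual_to_lone (adjoint (restrict_c0 Tc0) (c0_functional g)).

Definition matrix_row i : lone R := preadjoint (lone_unit i).

Lemma matrix_rowE i j : matrix_row i j = T (c0_unit j) i.
Proof. exact: pairing_unitl. Qed.

Lemma matrix_row_c0_matrix : c0_matrix (fun i => matrix_row i).
Proof.
split=> [i||j]; first exact: lone_valP.
  exists (`|T|) => i; rewrite -lone_normE c0_dual_to_lone_norm.
  apply: bop_norm_le => // x /=; rewrite pairing_unitl.
  apply: le_trans (linfty_norm_ub _ _) _; exact: bop_norm_ub.
rewrite (_ : (fun _ => _) = T (c0_unit j)).
  by apply: Tc0; exists (c0_unit j) => //; exact/asboolP/c0_valP.
by apply/funext => i; rewrite matrix_rowE.
Qed.

(** Both sides are bounded linear in g, hence determined by their values at the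
    unit vectors of l_1, where the equation is the row formula.  Defining the
    pre-adjoint from the restriction to c0 makes it l_1-valued at once, with no
    exchange of the two summations in g and f. *)
Lemma preadjointP : (forall f i, T f i = pairing (matrix_row i) f) ->
  forall f g, pairing g (T f) = pairing (preadjoint g) f.
Proof.
move=> Trow f g.
have lin : (fun g => pairing (preadjoint g) f : R^o) \in bounded_linear.
  apply/asboolP; split=> [a g1 g2|].
    rewrite -pairing_linearl -(linearP (@c0_dual_to_lone R)).
    congr (pairing (c0_dual_to_lone _) _); apply: bop_eqP => x.
    exact: (pairing_linearl (T x) a g1 g2).
  exists (`|f| * `|T|) => h; apply: le_trans (pairing_le _ _) _.
  rewrite -mulrA ler_wpM2l// c0_dual_to_lone_norm.
  apply: bop_norm_le => [|x]; first by rewrite mulr_ge0.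
  rewrite mulrAC; apply: le_trans (pairing_le _ _) _.
  by rewrite ler_wpM2r//; exact: bop_norm_ub.
rewrite -[RHS]/(Bop lin g) lone_dual_series.
by congr (pairing g); apply/funext => i; rewrite Trow.
Qed.

Lemma bidual_extensionP :
  (forall f, linfty_to_c0_bidual (T f) =
             adjoint (adjoint (restrict_c0 Tc0)) (linfty_to_c0_bidual f)) <->
  (forall f i, T f i = pairing (matrix_row i) f).
Proof.
split=> [Tbb f i|/preadjointP Tpre f].
  have := congr1 (fun Phi : dual (dual (c0 R)) => Phi (c0_functional (lone_unit i))) (Tbb f).
  rewrite -[LHS]/(pairing (c0_dual_to_lone (c0_functional (lone_unit i))) (T f)).
  by rewrite c0_functionalK pairing_unitl.
apply: bop_eqP => phi.
rewrite -[phi]c0_dual_to_loneK.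
rewrite -[LHS]/(pairing (c0_dual_to_lone (c0_functional (c0_dual_to_lone phi))) (T f)).
by rewrite c0_functionalK Tpre.
Qed.

End Preadjoint.
Arguments preadjoint {R T} Tc0 g.
Arguments matrix_row {R T} Tc0 i.
Arguments bidual_extensionP {R T} Tc0.

(** * Equivalence of each condition with the row formula *)

Section Equivalences.
Context {R : realType} {T : bop (linfty R) (linfty R)}.
Implicit Types (f : linfty R) (g : lone R).

(** The unit vectors span a dense subspace of c0, and c0 is closed in
    l_infty. *)
Lemma bop_c0_sub : (forall j, c0_set (T (c0_unit j))) ->
  T @` c0_set `<=` c0_set.
Proof.
move=> Tunit _ [f /asboolP f0 <-]; pose x := C0 f0.
apply/cvgrPdist_le => e e0.
have K0 : 0 < `|T| + 1 by rewrite ltr_wpDl.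
have eK0 : 0 < e / 2 / (`|T| + 1) by rewrite !divr_gt0.
have /cvgrPdist_le/(_ _ eK0)[n _ /(_ n (leqnn n))] := c0_trunc_cvg x.
rewrite sub0r normrN normr_id => xn.
have Tn0 : T (c0_trunc x n) \in is_c0.
  rewrite /c0_trunc [X in T X](_ : _ = \sum_(0 <= k < n) x k *: c0_val (c0_unit k)).
    rewrite linear_sum; apply: rpred_sum => k _; rewrite linearZ.
    by apply: rpredZ; exact/asboolP/Tunit.
  by elim/big_ind2: _ => // _ y1 _ y2 <- <-.
move: Tn0 => /asboolP/cvgrPdist_le/(_ (e / 2)); rewrite divr_gt0// => /(_ isT).
apply: filterS => i; rewrite !sub0r !normrN => Tni.
have -> : T f i = T (f - c0_trunc x n) i + T (c0_trunc x n) i.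
  rewrite -[RHS]/((T (f - c0_trunc x n) + T (c0_trunc x n)) i).
  by rewrite -linearD subrK.
rewrite [leRHS](splitr e); apply: le_trans (ler_normD _ _) _; apply: lerD => //.
apply: le_trans (linfty_norm_ub _ _) _; apply: le_trans (bop_norm_ub _ _) _.
apply: (@le_trans _ _ ((`|T| + 1) * (e / 2 / (`|T| + 1)))).
  by apply: ler_pM => //; rewrite lerDl.
by rewrite mulrC divfK// gt_eqF.
Qed.

(** Evaluating a representing matrix at the unit vectors shows that its entries
    are T(e_j)(i): it is the matrix of rows of T. *)
Lemma given_by_c0_matrixP : given_by_c0_matrix T <->
  exists Tc0 : T @` c0_set `<=` c0_set,
    forall f i, T f i = pairing (matrix_row Tc0 i) f.
Proof.
split=> [[b [b1 _ b0] Tb]|[Tc0 Trow]]; last first.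
  by exists (fun i => matrix_row Tc0 i) => //; exact: matrix_row_c0_matrix.
have Tunit i j : T (c0_unit j) i = b i j.
  by rewrite Tb -/(pairing _ _) pairingC pairing_unitl.
have Tc0 : T @` c0_set `<=` c0_set.
  apply: bop_c0_sub => j; rewrite /c0_set /=.
  by rewrite (_ : (T _ : nat -> R) = b^~ j)//; apply/funext => i; exact: Tunit.
exists Tc0 => f i; rewrite Tb -/(pairing _ _); congr (pairing _ f).
by apply/funext => j; rewrite matrix_rowE Tunit.
Qed.

Lemma weak_star_continuous (Tc0 : T @` c0_set `<=` c0_set) :
    (forall f i, T f i = pairing (matrix_row Tc0 i) f) ->
  continuous (T : linfty_weak_star R -> linfty_weak_star R).
Proof.
move=> /preadjointP Tpre f.
pose FF := @fmap_filter _ _ (T : linfty_weak_star R -> linfty_weak_star R) _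
  (nbhs_filter (f : linfty_weak_star R)).
apply/(@linfty_weak_star_cvgP R _ (T f) FF) => g.
rewrite Tpre.
have /linfty_weak_star_cvgP/(_ (preadjoint Tc0 g)) :
  nbhs (f : linfty_weak_star R) --> (f : linfty_weak_star R) by exact: cvg_id.
rewrite (_ : (fun h : linfty R => pairing (preadjoint Tc0 g) h) =
             (fun h => pairing g (T h))); first exact.
by apply/funext => h; rewrite /= Tpre.
Qed.

(** The product topology is coarser than the weak* topology on l_infty, so on
    the target nothing is to be done; on the source, the two have the same
    convergence on the ball. *)
Lemma within_ball_continuous :
    continuous (T : linfty_weak_star R -> linfty_weak_star R) ->
  {within linfty_ball R,
     continuous (T : linfty_pointwise R -> linfty_pointwise R)}.
Proof.
move=> Tc; apply/subspace_continuousP => f f1.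
apply/linfty_pointwise_cvgP => i.
have Ff : within (linfty_ball R) (nbhs (f : linfty_pointwise R)) -->
          (f : linfty_weak_star R).
  apply/linfty_weak_star_cvgP => g.
  apply: (@bounded_pointwise_cvg_pairing _ _ 1).
    exact: withinT.
  apply/linfty_pointwise_cvgP; exact: cvg_within.
have := cvg_trans (cvg_app T Ff) (Tc f) => /linfty_weak_star_cvgP/(_ (lone_unit i)).
rewrite pairing_unitl.
rewrite (_ : (fun h : linfty R => pairing (lone_unit i) h) = (fun h => h i)); first exact.
by apply/funext => h; exact: pairing_unitl.
Qed.

Definition unit_sum (u : nat -> R) n : c0 R := \sum_(0 <= k < n) u k *: c0_unit k.

Lemma unit_sumE u n j : unit_sum u n j = if (j < n)%N then u j else 0.
Proof.
elim: n => [|n IHn]; first by rewrite /unit_sum big_geq.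
rewrite /unit_sum big_nat_recr//= -/(unit_sum u n).
rewrite [LHS](_ : _ = unit_sum u n j + u n * unit_seq n j)// IHn /unit_seq ltnS.
by case: (ltngtP j n) => [||->]; rewrite ?mulr0 ?mulr1 ?addr0 ?add0r.
Qed.

(** The finite sections of f lie in the ball when f does and converge to f
    pointwise, though in general not in norm; their images have i-th coordinate
    equal to the partial sums of the row series. *)
Lemma row_formula_of_within_ball_continuous (Tc0 : T @` c0_set `<=` c0_set) :
    {within linfty_ball R,
       continuous (T : linfty_pointwise R -> linfty_pointwise R)} ->
  forall f i, T f i = pairing (matrix_row Tc0 i) f.
Proof.
move=> /subspace_continuousP Tc f i.
wlog f1 : f / `|f| <= 1.
  (* Both sides are linear in f, so f can be rescaled into the ball. *)
  move=> H; have [->|f0] := eqVneq f 0.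
    rewrite linear0 -[RHS]/(linfty_to_lone_dual 0 (matrix_row Tc0 i)).
    by rewrite linear0.
  have := H (`|f|^-1 *: f); rewrite normrZ normfV normr_id mulVf ?normr_eq0//.
  move=> /(_ (lexx _)); rewrite linearZ.
  rewrite -[RHS]/(linfty_to_lone_dual (`|f|^-1 *: f) (matrix_row Tc0 i)) linearZ.
  have cN0 : `|f|^-1 != 0 by rewrite invr_eq0 normr_eq0.
  by move=> Hs; exact: (mulfI cN0 Hs).
have secball n : `|c0_val (unit_sum f n)| <= 1.
  apply: linfty_norm_le => j; rewrite unit_sumE; case: ifP => _.
    by apply: le_trans (linfty_norm_ub _ _) _.
  by rewrite normr0.
have Ff : (fun n => c0_val (unit_sum f n)) @ \oo -->
          within (linfty_ball R) (nbhs (f : linfty_pointwise R)).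
  have /linfty_pointwise_cvgP : forall j, (fun h : linfty R => h j) @
       ((fun n => c0_val (unit_sum f n)) @ \oo) --> f j.
    move=> j; apply: cvg_near_cst; exists j.+1 => // n /= jn.
    by rewrite unit_sumE jn.
  move=> cf A nA; suff : nbhs \oo (fun n => A (c0_val (unit_sum f n))) by [].
  have : \forall n \near \oo, linfty_ball R (c0_val (unit_sum f n)) ->
                             A (c0_val (unit_sum f n)) := cf _ nA.
  by apply: filterS => n An; exact: (An (secball n)).
have := cvg_trans (cvg_app T Ff) (Tc f f1) => /linfty_pointwise_cvgP/(_ i) Tfi.
apply/esym/cvg_lim => //; move: Tfi.
rewrite [X in X --> _ -> _](_ : _ = series (fun j => matrix_row Tc0 i j * f j) @ \oo); first exact.
congr (_ @ \oo); apply/funext => n /=.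
transitivity (c0_functional (lone_unit i) (restrict_c0 Tc0 (unit_sum f n))).
  by rewrite /= pairing_unitl.
rewrite /unit_sum !linear_sum; apply: eq_bigr => k _.
by rewrite !linearZ/= pairing_unitl mulrC.
Qed.

End Equivalences.

Theorem theorem2p14 (R : realType) (T : bop (linfty R) (linfty R)) :
  [<-> (exists Tc0 : T @` c0_set `<=` c0_set,
          forall f : linfty R,
            linfty_to_c0_bidual (T f) =
            adjoint (adjoint (restrict_c0 Tc0)) (linfty_to_c0_bidual f));
       given_by_c0_matrix T;
       continuous (T : linfty_weak_star R -> linfty_weak_star R) /\
         T @` c0_set `<=` c0_set;
       {within linfty_ball R,
          continuous (T : linfty_pointwise R -> linfty_pointwise R)} /\
         T @` c0_set `<=` c0_set ].
Proof.
tfae.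
- move=> [Tc0 /bidual_extensionP Trow].
  by apply/given_by_c0_matrixP; exists Tc0.
- by move=> /given_by_c0_matrixP[Tc0 /weak_star_continuous Tc]; split.
- by move=> [/within_ball_continuous Tc Tc0].
- move=> [/row_formula_of_within_ball_continuous Trow Tc0].
  by exists Tc0; apply/bidual_extensionP/Trow.
Qed.
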